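(* Let $G$ and $H$ be groups in the class $\mathfrak{G}$. Then the following statements are equivalent: (i) $G$ and $H$ are isomorphic. (ii) For every differential graded $\mathbb{Q}$-algebra (DGA) $(A,d)$, one has $G\leq\operatorname{Aut}(A,d)$ if and only if $H\leq\operatorname{Aut}(A,d)$, where $\operatorname{Aut}(A,d)$ denotes the automorphism group of $(A,d)$.
   Context: A DGA is a differential graded algebra over $\mathbb{Q}$: a graded associative unital $\mathbb{Q}$-algebra $A$ with a differential $d$ (a derivation of degree $+1$ with $d^2=0$). $\operatorname{Aut}(A,d)$ is the group of degree-preserving unital algebra automorphisms of $A$ commuting with $d$. For groups $G$ and $\Gamma$, the notation $G\leq \Gamma$ means that $G$ is isomorphic to a subgroup of $\Gamma$ (so $G \leq \operatorname{Aut}(A,d)$ means that $G$ acts faithfully on $(A,d)$ by DGA automorphisms). A (simple, undirected) graph $\mathcal{G}=(V,E)$ consists of a set $V$ of vertices (possibly infinite) and a set $E$ of $2$-element subsets $[v,w]$ of $V$, called edges. The degree of $v\in V$ is $|\{w\in V : [v,w]\in E\}|$, and $\mathcal{G}$ is locally finite if every vertex has finite degree. A homomorphism of graphs $(V_1,E_1)\to(V_2,E_2)$ is a map $f\colon V_1\to V_2$ with $[f(v),f(w)]\in E_2$ whenever $[v,w]\in E_1$; an automorphism is an invertible homomorphism from a graph to itself (with inverse also a homomorphism), and $\operatorname{Aut}(\mathcal{G})$ is the group of automorphisms of $\mathcal{G}$. A group is co-Hopfian if it is not isomorphic to any of its proper subgroups. A group $G$ is in the class $\mathfrak{G}$ if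 the following three conditions hold: (1) there exists a connected locally finite graph $\mathcal{G}$ such that $G\cong\operatorname{Aut}(\mathcal{G})$; (2) $G$ is co-Hopfian; (3) every abelian normal subgroup of $G$ is torsion (i.e. all its elements have finite order). *)

(* Defs.v *)
From HB Require Import structures.
From mathcomp Require Import all_boot all_order all_algebra.
From mathcomp Require Import boolp classical_sets cardinality.
From Stdlib Require Import Relation_Operators.

Set Implicit Arguments.
Unset Strict Implicit.
Unset Printing Implicit Defensive.

Import GRing.Theory.

Definition isomorphic (G H : groupType) : Prop :=
  exists f : {multiplicative G -> H}, bijective f.

Section Subgroup.
Variables (G : groupType) (K : groupClosed G).

Definition subgroup : Type := {x : G | x \in K}.

Fact subgroup_group_closed : group_closed K.
Proof. by split; [exact: gpred1 | exact: gpredF]. Qed.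

HB.instance Definition _ := SubChoice.copy subgroup {x : G | x \in K}.
HB.instance Definition _ :=
  SubChoice_isSubGroup.Build G (fun x => x \in K) subgroup
    subgroup_group_closed.
End Subgroup.

Definition embeds (G Gamma : groupType) : Prop :=
  exists K : groupClosed Gamma, isomorphic G (subgroup K).

Definition co_hopfian (G : groupType) : Prop :=
  forall K : groupClosed G, isomorphic G (subgroup K) -> forall x, x \in K.

Definition abelian_subgroup (G : groupType) (K : groupClosed G) : Prop :=
  {in K &, forall x y, x * y = y * x}%g.

Definition normal_subgroup (G : groupType) (K : groupClosed G) : Prop :=
  forall x y, x \in K -> (x ^ y)%g \in K.

Definition torsion_subgroup (G : groupType) (K : groupClosed G) : Prop :=
  {in K, forall x, exists2 n, 0 < n & (x ^+ n = 1)%g}.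

Record selfbij (T : Type) := SelfBij {
  fwd :> T -> T;
  bwd : T -> T;
  fwdK : cancel fwd bwd;
  bwdK : cancel bwd fwd
}.

Section SelfBijGroup.
Variable T : Type.
Implicit Types f g h : selfbij T.

Lemma selfbij_ext f g : fwd f =1 fwd g -> f = g.
Proof.
case: f g => [f f' fK f'K] [g g' gK g'K] /= /funext fg.
rewrite -{g}fg in gK g'K *.
have e : f' = g' by apply/funext => x; rewrite -{1}(g'K x) fK.
rewrite -{g'}e in gK g'K *.
by congr SelfBij; exact: Prop_irrelevance.
Qed.

HB.instance Definition _ := gen_eqMixin (selfbij T).
HB.instance Definition _ := gen_choiceMixin (selfbij T).

Definition selfbij_one : selfbij T := @SelfBij T id id (frefl id) (frefl id).
Definition selfbij_inv f : selfbij T := SelfBij (bwdK f) (fwdK f).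
Definition selfbij_mul f g : selfbij T :=
  SelfBij (can_comp (fwdK f) (fwdK g)) (can_comp (bwdK g) (bwdK f)).

Fact selfbij_mulA : associative selfbij_mul.
Proof. by move=> f g h; apply: selfbij_ext. Qed.
Fact selfbij_mul1 : left_id selfbij_one selfbij_mul.
Proof. by move=> f; apply: selfbij_ext. Qed.
Fact selfbij_mulr1 : right_id selfbij_one selfbij_mul.
Proof. by move=> f; apply: selfbij_ext. Qed.
Fact selfbij_mulV : left_inverse selfbij_one selfbij_inv selfbij_mul.
Proof. by move=> f; apply: selfbij_ext => x /=; rewrite fwdK. Qed.
Fact selfbij_mulrV : right_inverse selfbij_one selfbij_inv selfbij_mul.
Proof. by move=> f; apply: selfbij_ext => x /=; rewrite bwdK. Qed.

HB.instance Definition _ := isGroup.Build (selfbij T)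
  selfbij_mulA selfbij_mul1 selfbij_mulr1 selfbij_mulV selfbij_mulrV.
End SelfBijGroup.

Record graph := Graph {
  vertex :> Type;
  edge : vertex -> vertex -> Prop;
  edge_sym : forall v w, edge v w -> edge w v;
  edge_irrefl : forall v, ~ edge v v
}.

Definition locally_finite (X : graph) : Prop :=
  forall v : X, finite_set [set w | edge v w].

(* The empty graph counts as connected; like a single vertex, it has a trivial
   automorphism group. *)
Definition connected_graph (X : graph) : Prop :=
  forall v w : X, clos_refl_trans X (@edge X) v w.

Definition graph_hom (X Y : graph) (f : X -> Y) : Prop :=
  forall v w, edge v w -> edge (f v) (f w).

Section AutGraph.
Variable X : graph.

Definition graph_aut : {pred selfbij X} :=
  fun f => `[< graph_hom (fwd f) /\ graph_hom (bwd f) >].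

Fact graph_aut_mul : mulg_closed graph_aut.
Proof.
move=> f g /asboolP[f1 f2] /asboolP[g1 g2]; apply/asboolP; split=> v w vw /=.
  exact/f1/g1.
exact/g2/f2.
Qed.
Fact graph_aut_one : (1%g : selfbij X) \in graph_aut.
Proof. by apply/asboolP; split. Qed.
Fact graph_aut_inv : invg_closed graph_aut.
Proof. by move=> f /asboolP[? ?]; apply/asboolP; split. Qed.

HB.instance Definition _ := isMulClosed.Build (selfbij X) graph_aut graph_aut_mul.
HB.instance Definition _ := isMul1Closed.Build (selfbij X) graph_aut graph_aut_one.
HB.instance Definition _ := isInvClosed.Build (selfbij X) graph_aut graph_aut_inv.

Definition Aut_graph : groupType := subgroup graph_aut.
End AutGraph.

Local Open Scope ring_scope.

(* The grading is by int, and internal: [homog n] is the subspace of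
   homogeneous elements of degree n, and [homog_span], [homog_free] say that
   the algebra is the direct sum of these subspaces. An algType is nonzero;
   the zero DGA, left out for that reason, has the same (trivial)
   automorphism group as the DGA reduced to rat in degree 0. *)
Record dga := DGA {
  dga_alg :> algType rat;
  homog : int -> set dga_alg;
  homog_zero : forall n, homog n 0;
  homog_linear : forall n a x y, homog n x -> homog n y -> homog n (a *: x + y);
  homog_span : forall x, exists s : seq int, exists2 u : int -> dga_alg,
    (forall n, homog n (u n)) & x = \sum_(n <- s) u n;
  homog_free : forall (s : seq int) (u : int -> dga_alg), uniq s ->
    (forall n, homog n (u n)) -> \sum_(n <- s) u n = 0 ->
    forall n, n \in s -> u n = 0;
  homog_one : homog 0 1;
  homog_mul : forall m n x y, homog m x -> homog n y -> homog (m + n) (x * y);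
  diff : {linear dga_alg -> dga_alg};
  diff_homog : forall n x, homog n x -> homog (n + 1) (diff x);
  diff_mul : forall n x y, homog n x ->
    diff (x * y) = diff x * y + (-1 : rat) ^ n *: (x * diff y);
  diff_diff : forall x, diff (diff x) = 0
}.

Record dga_hom (A B : dga) (f : A -> B) : Prop := DGAHom {
  dga_hom_linear : linear f;
  dga_hom_one : f 1 = 1;
  dga_hom_mul : {morph f : x y / x * y};
  dga_hom_homog : forall n x, homog n x -> homog n (f x);
  dga_hom_diff : forall x, f (diff A x) = diff B (f x)
}.

Section AutDGA.
Variable A : dga.

Definition dga_aut : {pred selfbij A} :=
  fun f => `[< dga_hom (fwd f) /\ dga_hom (bwd f) >].

Fact dga_hom_id : dga_hom (@id A).
Proof. by split. Qed.

Fact dga_hom_comp (f g : A -> A) : dga_hom f -> dga_hom g -> dga_hom (f \o g).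
Proof.
move=> [f1 f2 f3 f4 f5] [g1 g2 g3 g4 g5]; split=> /=.
- by move=> a x y; rewrite /= g1 f1.
- by rewrite g2 f2.
- by move=> x y; rewrite /= g3 f3.
- by move=> n x xn; exact/f4/g4.
- by move=> x; rewrite g5 f5.
Qed.

Fact dga_aut_mul : mulg_closed dga_aut.
Proof.
move=> f g /asboolP[f1 f2] /asboolP[g1 g2]; apply/asboolP.
by split; apply: dga_hom_comp.
Qed.
Fact dga_aut_one : (1%g : selfbij A) \in dga_aut.
Proof. by apply/asboolP; split; exact: dga_hom_id. Qed.
Fact dga_aut_inv : invg_closed dga_aut.
Proof. by move=> f /asboolP[? ?]; apply/asboolP; split. Qed.

HB.instance Definition _ := isMulClosed.Build (selfbij A) dga_aut dga_aut_mul.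
HB.instance Definition _ := isMul1Closed.Build (selfbij A) dga_aut dga_aut_one.
HB.instance Definition _ := isInvClosed.Build (selfbij A) dga_aut dga_aut_inv.

Definition Aut_dga : groupType := subgroup dga_aut.
End AutDGA.

Record in_class (G : groupType) : Prop := InClass {
  class_graph : exists X : graph,
    [/\ connected_graph X, locally_finite X & isomorphic G (Aut_graph X)];
  class_co_hopfian : co_hopfian G;
  class_torsion : forall K : groupClosed G,
    abelian_subgroup K -> normal_subgroup K -> torsion_subgroup K
}.

(* Main.v *)
Require Import Defs.
From mathcomp Require Import all_boot.
From HB Require Import structures.
From mathcomp Require Import all_algebra ring.
From mathcomp Require Import boolp classical_sets functions.

Set Implicit Arguments.
Unset Strict Implicit.
Unset Printing Implicit Defensive.

Import GRing.Theory.

(** To a graph X with at least one vertex one attaches the DGA A of its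
    truncated cochains: A^0 consists of the functions on the vertices, A^1 of
    the functions on the arcs (the edges with a direction), the product is
    the cup product
      (ab)(v) = a(v) b(v),   (ab)(v,w) = a(v) b(v,w) + a(v,w) b(w),
    and the differential is the coboundary (da)(v,w) = a(w) - a(v). The whole
    point is that Aut(A) is exactly Aut(X) ([Aut_cochain_dga]).

    An automorphism f of A permutes the minimal idempotents of A^0, and these
    are the indicator functions delta_v of the vertices
    ([minimal_idempotent_delta]); so f defines a permutation s of the vertices.
    The product delta_v * d(delta_w) with v <> w is the indicator function of
    the arc (v,w) if v and w are adjacent, and 0 otherwise. Since f commutes
    with d it follows both that s preserves adjacency ([dga_hom_edge]) and
    that f sends the indicator function of each arc to that of its image,
    without a scalar factor; without d, each arc could be rescaled freely.
    Finally any a in A is recovered from the products delta_v * a * delta_w,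
    so f is the relabelling by s ([dga_hom_pullback]).

    A group G in the class is therefore the automorphism group of some DGA A.
    Testing the second condition of the theorem on this A shows that H embeds
    into G, and by symmetry G embeds into H. The composite G -> H -> G is
    injective, hence onto because G is co-Hopfian, so that H -> G is an
    isomorphism ([co_hopfian_isomorphic]). *)

(** * Embeddings of groups *)

Section MorphismImage.
Variables (G H : groupType) (f : {multiplicative G -> H}).

Definition morph_image : {pred H} := fun y => `[< exists x, f x = y >].

Lemma group_morph1 : f 1%g = 1%g.
Proof. by apply: (mulgI (f 1%g)); rewrite -gmulfM !mulg1. Qed.

Fact morph_image_mul : mulg_closed morph_image.
Proof.
move=> _ _ /asboolP[x <-] /asboolP[y <-]; apply/asboolP.
by exists (x * y)%g; rewrite gmulfM.
Qed.
Fact morph_image_one : (1%g : H) \in morph_image.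
Proof. by apply/asboolP; exists 1%g; exact: group_morph1. Qed.
Fact morph_image_inv : invg_closed morph_image.
Proof.
move=> _ /asboolP[x <-]; apply/asboolP; exists x^-1%g.
by apply: (mulgI (f x)); rewrite -gmulfM !mulgV group_morph1.
Qed.

HB.instance Definition _ := isMulClosed.Build H morph_image morph_image_mul.
HB.instance Definition _ := isMul1Closed.Build H morph_image morph_image_one.
HB.instance Definition _ := isInvClosed.Build H morph_image morph_image_inv.
End MorphismImage.

Lemma inj_surj_isomorphic (G H : groupType) (f : {multiplicative G -> H}) :
  injective f -> (forall y, exists x, f x = y) -> isomorphic G H.
Proof.
move=> f_inj /choice[g fK]; exists f; exists g => // x.
by apply: f_inj; rewrite fK.
Qed.

Lemma isomorphic_morph_image (G H : groupType) (f : {multiplicative G -> H}) :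
  injective f -> isomorphic G (subgroup (morph_image f)).
Proof.
move=> f_inj.
have fP x : f x \in morph_image f by apply/asboolP; exists x.
pose g x : subgroup (morph_image f) := exist _ (f x) (fP x).
have gM : {morph g : x y / (x * y)%g}.
  by move=> x y; apply/val_inj; rewrite /= gmulfM.
pose g' : {multiplicative G -> subgroup (morph_image f)} :=
  HB.pack g (isMultiplicative.Build _ _ g gM).
apply: (@inj_surj_isomorphic _ _ g').
  by move=> x y /(congr1 val)/f_inj.
by move=> [y yP]; case/asboolP: (yP) => x e; exists x; apply/val_inj.
Qed.

Lemma embedsP (G H : groupType) :
  embeds G H <-> exists f : {multiplicative G -> H}, injective f.
Proof.
split=> [[K [f f_bij]]|[f /isomorphic_morph_image fG]]; last first.
  by eexists; exact: fG.
by exists (val \o f); apply: inj_comp val_inj (bij_inj f_bij).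
Qed.

Lemma isomorphic_embeds (G H : groupType) : isomorphic G H -> embeds G H.
Proof. by case=> f /bij_inj f_inj; apply/embedsP; exists f. Qed.

Lemma embeds_trans (G H K : groupType) : embeds G H -> embeds H K -> embeds G K.
Proof.
move=> /embedsP[f f_inj] /embedsP[g g_inj]; apply/embedsP.
by exists (g \o f); apply: inj_comp.
Qed.

Lemma isomorphic_sym (G H : groupType) : isomorphic G H -> isomorphic H G.
Proof.
case=> f [g fK gK].
have gM := can2_gmulfM fK gK.
pose g' : {multiplicative H -> G} :=
  HB.pack g (isMultiplicative.Build _ _ g gM).
by exists g'; exists f.
Qed.

(** The composite G -> H -> G is onto, so the second map, injective by
    assumption, is onto as well. *)
Lemma co_hopfian_isomorphic (G H : groupType) :
  co_hopfian G -> embeds G H -> embeds H G -> isomorphic G H.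
Proof.
move=> hG /embedsP[f f_inj] /embedsP[g g_inj].
apply/isomorphic_sym/(inj_surj_isomorphic g_inj) => x.
have /hG/(_ x)/asboolP[y <-] := isomorphic_morph_image (inj_comp g_inj f_inj).
by exists (f y).
Qed.

Lemma subsingleton_isomorphic (G H : groupType) :
  (forall x y : G, x = y) -> (forall x y : H, x = y) -> isomorphic G H.
Proof.
by move=> G1 H1; exists (@one_fun G H); exists (@one_fun H G).
Qed.

Lemma subsingleton_Aut_graph (X : graph) :
  (forall v w : X, v = w) -> forall f g : Aut_graph X, f = g.
Proof. by move=> X1 f g; apply/val_inj/selfbij_ext. Qed.

Local Open Scope ring_scope.

(** * The cochain algebra of a graph *)

Definition arc (X : graph) : Type := {p : X * X | edge p.1 p.2}.
Definition src (X : graph) (e : arc X) : X := (sval e).1.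
Definition tgt (X : graph) (e : arc X) : X := (sval e).2.
Definition simplex (X : graph) : Type := (X + arc X)%type.

Lemma arc_ext (X : graph) (e e' : arc X) :
  src e = src e' -> tgt e = tgt e' -> e = e'.
Proof.
case: e e' => [[v w] vw] [[v' w'] vw']; rewrite /src /tgt /= => ev ew.
by subst v' w'; congr exist; apply: Prop_irrelevance.
Qed.

Lemma edge_neq (X : graph) (v w : X) : edge v w -> v <> w.
Proof. by move=> /[swap] -> /edge_irrefl. Qed.

Lemma arc_neq (X : graph) (e : arc X) : src e <> tgt e.
Proof. exact: edge_neq (svalP e). Qed.

(** Both degrees are kept in a single function space, so that the module
    structure is the pointwise one. The vertex x0 witnesses that the algebra is
    nonzero. *)
Definition cochain (X : graph) (x0 : X) : Type := simplex X -> rat.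

Section Cochain.
Variables (X : graph) (x0 : X).
Implicit Types (a b c : cochain x0) (v w : X) (e : arc X) (s : simplex X).

HB.instance Definition _ :=
  GRing.Lmodule.copy (cochain x0) (simplex X -> rat^o).

Definition cup a b : cochain x0 := fun s =>
  match s with
  | inl v => a (inl v) * b (inl v)
  | inr e => a (inl (src e)) * b (inr e) + a (inr e) * b (inl (tgt e))
  end.

Definition cochain1 : cochain x0 := fun s => if s is inl _ then 1 else 0.

Lemma cochainD a b s : (a + b) s = a s + b s. Proof. by []. Qed.
Lemma cochainZ (k : rat) a s : (k *: a) s = k * a s. Proof. by []. Qed.
Lemma cochain0 s : (0 : cochain x0) s = 0. Proof. by []. Qed.

Fact cupA : associative cup.
Proof. by move=> a b c; apply/funext => -[v|e] /=; ring. Qed.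
Fact cup1l : left_id cochain1 cup.
Proof. by move=> a; apply/funext => -[v|e] /=; ring. Qed.
Fact cup1r : right_id cochain1 cup.
Proof. by move=> a; apply/funext => -[v|e] /=; ring. Qed.
Fact cupDl : left_distributive cup +%R.
Proof.
by move=> a b c; apply/funext => -[v|e]; rewrite cochainD /= !cochainD; ring.
Qed.
Fact cupDr : right_distributive cup +%R.
Proof.
by move=> a b c; apply/funext => -[v|e]; rewrite cochainD /= !cochainD; ring.
Qed.
Fact cochain1_neq0 : cochain1 != 0.
Proof. by apply/eqP => /(congr1 (fun a => a (inl x0))). Qed.

HB.instance Definition _ := GRing.Zmodule_isNzRing.Build (cochain x0)
  cupA cup1l cup1r cupDl cupDr cochain1_neq0.

Lemma cochainMl a b v : (a * b) (inl v) = a (inl v) * b (inl v).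
Proof. by []. Qed.
Lemma cochainMr a b e :
  (a * b) (inr e) = a (inl (src e)) * b (inr e) + a (inr e) * b (inl (tgt e)).
Proof. by []. Qed.

Fact cup_scalel (k : rat) a b : k *: (a * b) = (k *: a) * b.
Proof.
by apply/funext => -[v|e];
  rewrite !(cochainZ, cochainMl, cochainMr) ?cochainZ; ring.
Qed.
HB.instance Definition _ :=
  GRing.Lmodule_isLalgebra.Build rat (cochain x0) cup_scalel.

Fact cup_scaler (k : rat) a b : k *: (a * b) = a * (k *: b).
Proof.
by apply/funext => -[v|e];
  rewrite !(cochainZ, cochainMl, cochainMr) ?cochainZ; ring.
Qed.
HB.instance Definition _ :=
  GRing.Lalgebra_isAlgebra.Build rat (cochain x0) cup_scaler.

Definition coboundary a : cochain x0 := fun s =>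
  if s is inr e then a (inl (tgt e)) - a (inl (src e)) else 0.

Fact coboundary_linear : linear coboundary.
Proof.
move=> k a b; apply/funext => -[v|e]; rewrite cochainD cochainZ /=.
  by rewrite mulr0 addr0.
by rewrite !cochainD !cochainZ; ring.
Qed.
HB.instance Definition _ :=
  GRing.isLinear.Build rat (cochain x0) (cochain x0) _ coboundary
    coboundary_linear.

(** * The cochain algebra as a DGA *)

Definition deg s : int := if s is inl _ then 0 else 1.

Definition cochain_homog (n : int) : set (cochain x0) :=
  fun a => forall s, deg s != n -> a s = 0.

Definition cochain_part a (n : int) : cochain x0 :=
  fun s => if deg s == n then a s else 0.

Lemma cochain_sum (I : Type) (r : seq I) (u : I -> cochain x0) s :
  (\sum_(i <- r) u i) s = \sum_(i <- r) u i s.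
Proof. by elim/big_rec2: _ => // i _ y _ <-. Qed.

Fact cochain_homog_zero n : cochain_homog n 0.
Proof. by []. Qed.

Fact cochain_homog_linear n (k : rat) a b :
  cochain_homog n a -> cochain_homog n b -> cochain_homog n (k *: a + b).
Proof.
by move=> ha hb s hs; rewrite cochainD cochainZ ha // hb // mulr0 addr0.
Qed.

Fact cochain_homog_span a : exists r : seq int,
  exists2 u : int -> cochain x0,
    (forall n, cochain_homog n (u n)) & a = \sum_(n <- r) u n.
Proof.
exists [:: 0; 1]; exists (cochain_part a) => [n s|].
  by rewrite /cochain_part; case: eqP.
apply/funext => s; rewrite cochain_sum big_cons big_seq1 /cochain_part.
by case: s => ? /=; rewrite ?addr0 ?add0r.
Qed.

Fact cochain_homog_free (r : seq int) (u : int -> cochain x0) : uniq r ->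
  (forall n, cochain_homog n (u n)) -> \sum_(n <- r) u n = 0 ->
  forall n, n \in r -> u n = 0.
Proof.
move=> ur hu u0 n nr; apply/funext => s.
have [sn|] := eqVneq (deg s) n; last by move/hu.
move: (congr1 (fun a => a s) u0); rewrite cochain_sum (bigD1_seq n) //=.
by rewrite big1 ?addr0 // => m mn; apply: hu; rewrite sn eq_sym.
Qed.

Fact cochain_homog_one : cochain_homog 0 1.
Proof. by case. Qed.

Fact cochain_homog_mul m n a b :
  cochain_homog m a -> cochain_homog n b -> cochain_homog (m + n) (a * b).
Proof.
have [->|m0] := eqVneq m 0.
  move=> ha hb [v|e]; rewrite add0r /= => hs.
    by rewrite cochainMl hb // mulr0.
  by rewrite cochainMr hb // (ha (inr e)) // mulr0 mul0r addr0.
(* If m != 0 then a vanishes on vertices, and only m = 1 leaves anything. *)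
move=> ha hb [v|e] hs; have a0 w : a (inl w) = 0 by apply: ha; rewrite eq_sym.
  by rewrite cochainMl a0 mul0r.
rewrite cochainMr a0 mul0r add0r.
have [m1|] := eqVneq m 1; last first.
  by rewrite eq_sym => /(ha (inr e)) ->; rewrite mul0r.
rewrite (hb (inl _)) ?mulr0 //=; apply: contraNneq hs => <-.
by rewrite m1 addr0.
Qed.

Fact coboundary_homog n a :
  cochain_homog n a -> cochain_homog (n + 1) (coboundary a).
Proof.
move=> ha [v|e] hs //=; rewrite !ha ?subrr //=;
  by apply: contraNneq hs => <-; rewrite add0r.
Qed.

(** On arcs the Leibniz rule is a(w)b(w) - a(v)b(v) = (a(w) - a(v)) b(w) +
    a(v) (b(w) - b(v)). For n != 0 all terms vanish, so the sign only matters
    for n = 0, where it is 1. *)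
Fact coboundary_mul n a b : cochain_homog n a ->
  coboundary (a * b) = coboundary a * b + (-1 : rat) ^ n *: (a * coboundary b).
Proof.
move=> ha; apply/funext => -[v|e]; rewrite cochainD cochainZ.
  by rewrite !cochainMl /= mul0r !mulr0 addr0.
rewrite !cochainMr /= !cochainMl.
have [->|n0] := eqVneq n 0; first by rewrite expr0z; ring.
have a0 w : a (inl w) = 0 by apply: ha; rewrite eq_sym.
by rewrite !a0; ring.
Qed.

Fact coboundaryK a : coboundary (coboundary a) = 0.
Proof. by apply/funext => -[v|e] //=; rewrite subrr. Qed.

Definition cochain_dga : dga :=
  @DGA (cochain x0) cochain_homog cochain_homog_zero cochain_homog_linear
    cochain_homog_span cochain_homog_free cochain_homog_one cochain_homog_mul
    coboundary coboundary_homog coboundary_mul coboundaryK.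

(** * Indicator functions of vertices and arcs *)

Definition delta v : cochain x0 := fun s =>
  if s is inl w then (`[< w = v >])%:R else 0.

Lemma delta_homog v : cochain_homog 0 (delta v).
Proof. by case. Qed.

Lemma deltaE v w : delta v (inl w) = (`[< w = v >])%:R. Proof. by []. Qed.

Lemma delta_refl v : delta v (inl v) = 1.
Proof. by rewrite deltaE; case: asboolP. Qed.

Lemma delta_inj : injective delta.
Proof.
move=> v w vw; have := delta_refl v; rewrite vw deltaE.
by case: asboolP.
Qed.

Lemma delta_neq0 v : delta v <> 0.
Proof. by move/(congr1 (fun a => a (inl v))); rewrite delta_refl. Qed.

Lemma delta_idem v : delta v * delta v = delta v.
Proof.
apply/funext => -[w|e]; rewrite ?cochainMl ?cochainMr /=; last by ring.
by case: asboolP => _; rewrite ?mulr1 ?mulr0.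
Qed.

Lemma mul_delta a v : cochain_homog 0 a -> a * delta v = a (inl v) *: delta v.
Proof.
move=> ha; apply/funext => -[w|e]; rewrite cochainZ ?cochainMl ?cochainMr /=.
  by case: asboolP => [->|_] //; rewrite !mulr0.
by rewrite (ha (inr e)) // mul0r !mulr0 addr0.
Qed.

Lemma delta_mul a v : cochain_homog 0 a -> delta v * a = a (inl v) *: delta v.
Proof.
move=> ha; apply/funext => -[w|e]; rewrite cochainZ ?cochainMl ?cochainMr /=.
  by case: asboolP => [->|_]; rewrite ?mul1r ?mulr1 // mul0r mulr0.
by rewrite (ha (inr e)) // mul0r !mulr0 addr0.
Qed.

(** Multiplying a by delta v for a vertex v with a(v) != 0 shows that a is
    proportional to delta v, and idempotency fixes the factor. This algebraic
    description of the indicator functions is what automorphisms preserve. *)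
Lemma minimal_idempotent_delta a : cochain_homog 0 a -> a <> 0 -> a * a = a ->
  (forall b, cochain_homog 0 b -> exists k : rat, a * b = k *: a) ->
  exists v, a = delta v.
Proof.
move=> ha a_neq0 aa a_min.
have [v av] : exists v, a (inl v) != 0.
  apply/not_existsP => a0; apply: a_neq0; apply/funext => -[v|e].
    by apply/eqP; apply: contra_notT (a0 v).
  by rewrite ha.
exists v; have [k] := a_min _ (delta_homog v).
rewrite mul_delta // => /[dup] /(congr1 (fun b => b (inl v))).
rewrite !cochainZ delta_refl mulr1 -{1}[a (inl v)]mul1r => /(mulIf av) <-.
rewrite scale1r => <-.
move: (congr1 (fun b => b (inl v)) aa).
by rewrite cochainMl -{3}[a (inl v)]mul1r => /(mulIf av) ->; rewrite scale1r.
Qed.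

(** The component on arcs vanishes because the graph has no loops. *)
Lemma delta_sandwich a v : delta v * a * delta v = a (inl v) *: delta v.
Proof.
apply/funext => -[w|e]; rewrite cochainZ ?cochainMl ?cochainMr /=.
  by case: asboolP => [->|_]; rewrite ?mul1r // !mulr0.
rewrite !mulr0 add0r mul0r addr0.
case: asboolP => [sv|_]; last by rewrite !mul0r.
case: asboolP => [tv|_]; last by rewrite mulr0.
by case: (@arc_neq _ e); rewrite sv tv.
Qed.

(** Both sides are multiples of the indicator function of e, which is the
    product of delta (src e) with the coboundary of delta (tgt e). *)
Lemma delta_arc a e :
  delta (src e) * a * delta (tgt e) =
  a (inr e) *: (delta (src e) * coboundary (delta (tgt e))).
Proof.
have /asboolPn/negbTE st := @arc_neq _ e.
apply/funext => -[w|e']; rewrite cochainZ ?cochainMl ?cochainMr /=.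
  rewrite !mulr0; case: asboolP => [->|_]; last by rewrite /=; ring.
  by rewrite st /=; ring.
rewrite !mulr0 add0r mul0r addr0.
case: asboolP => [ss|_]; last by rewrite /=; ring.
rewrite ss st; case: asboolP => [tt|_]; last by rewrite /=; ring.
by rewrite (arc_ext ss tt) /=; ring.
Qed.

Lemma delta_arc_refl e :
  (delta (src e) * coboundary (delta (tgt e))) (inr e) = 1.
Proof.
have /asboolPn/negbTE st := @arc_neq _ e.
rewrite cochainMr /= st mul0r addr0 subr0.
by case: asboolP => // _; case: asboolP => // _; rewrite mulr1.
Qed.

(** Adjacency can be read off from the DGA structure. The case v = w has to be
    excluded: delta v times its own coboundary is minus the indicator function
    of the arcs that start at v. *)
Lemma edge_delta v w :
  edge v w <-> v <> w /\ delta v * coboundary (delta w) <> 0.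
Proof.
split=> [vw|[vw dvw]].
  split; first exact: edge_neq vw.
  move/(congr1 (fun a => a (inr (exist _ (v, w) vw)))).
  by rewrite (delta_arc_refl (exist _ (v, w) vw)).
apply: contrapT => nvw; apply: dvw; apply/funext => -[u|[[s t] st]].
  by rewrite cochainMl /= mulr0.
rewrite cochainMr /= /src /tgt /= mul0r addr0 cochain0.
case: asboolP => [sv|_]; last by rewrite mul0r.
case: asboolP => [tw|_]; first by move: st; rewrite sv tw.
by case: asboolP => [sw|_]; [move: vw; rewrite -sv sw | rewrite subrr mulr0].
Qed.

End Cochain.

(** * Functoriality *)

Section Pullback.
Variables (X Y : graph) (x0 : X) (y0 : Y) (f : X -> Y) (hf : graph_hom f).

Definition arc_map (e : arc X) : arc Y :=
  exist _ (f (src e), f (tgt e)) (hf (svalP e)).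

Definition simplex_map (s : simplex X) : simplex Y :=
  match s with inl v => inl (f v) | inr e => inr (arc_map e) end.

Definition pullback (a : cochain y0) : cochain x0 := fun s => a (simplex_map s).

Lemma pullback_dga_hom :
  dga_hom (pullback : cochain_dga y0 -> cochain_dga x0).
Proof.
split.
- by move=> k a b; apply/funext.
- by apply/funext => -[].
- by move=> a b; apply/funext => -[].
- by move=> n a ha [v|e] hs; apply: ha.
- by move=> a; apply/funext => -[].
Qed.
End Pullback.
Arguments pullback {X Y} x0 y0 {f} hf a _.

Lemma pullback_cancel (X Y : graph) (x0 : X) (y0 : Y) (f : X -> Y) (g : Y -> X)
    (hf : graph_hom f) (hg : graph_hom g) :
  cancel f g -> cancel (pullback y0 x0 hg) (pullback x0 y0 hf).
Proof.
move=> fK a; apply/funext => -[v|e]; rewrite /pullback /=; first by rewrite fK.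
by congr (a (inr _)); apply: arc_ext; apply: fK.
Qed.

Arguments pullback_cancel {X Y} x0 y0 {f g} hf hg _ _.

Lemma pullback_delta (X Y : graph) (x0 : X) (y0 : Y) (f : X -> Y) (g : Y -> X)
    (hf : graph_hom f) v :
  cancel f g -> cancel g f -> pullback x0 y0 hf (delta y0 v) = delta x0 (g v).
Proof.
move=> fK gK; apply/funext => -[u|e] //; rewrite /pullback /=.
by congr (nat_of_bool _)%:R; apply: asbool_equiv_eq; split=> [<-|->].
Qed.

Lemma dga_homZ (A B : dga) (f : A -> B) : dga_hom f ->
  forall (k : rat) a, f (k *: a) = k *: f a.
Proof. by move=> /dga_hom_linear/GRing.scalable_linear fZ k a; apply: fZ. Qed.

Lemma dga_hom0 (A B : dga) (f : A -> B) : dga_hom f -> f 0 = 0.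
Proof. by move=> hf; rewrite -(scale0r (0 : A)) (dga_homZ hf) scale0r. Qed.

(** * Automorphisms of the cochain algebra *)

Section CochainAut.
Variables (X : graph) (x0 : X).
Local Notation A := (cochain_dga x0).
Local Notation delta := (delta x0).

(** Minimality of the idempotent f (delta v) is transported from delta v:
    each b in degree 0 is f of an element of degree 0, namely g b. *)
Lemma dga_hom_delta (f g : A -> A) : dga_hom f -> dga_hom g ->
  cancel f g -> cancel g f ->
  exists s : X -> X, forall v, f (delta v) = delta (s v).
Proof.
move=> hf hg fK gK.
suff /choice[s sP] : forall v, exists w, f (delta v) = delta w by exists s.
move=> v.
apply: minimal_idempotent_delta.
- exact/(dga_hom_homog hf)/delta_homog.
- by rewrite -(dga_hom0 hf) => /(can_inj fK)/delta_neq0.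
- by rewrite -[LHS](dga_hom_mul hf) [X in f X]delta_idem.
move=> b hb; exists ((g b : cochain x0) (inl v)).
rewrite -{1}(gK b) -[LHS](dga_hom_mul hf) -[RHS](dga_homZ hf).
by congr f; apply: delta_mul; apply: (dga_hom_homog hg hb).
Qed.

Section DeltaMap.
Variables (f g : A -> A) (s : X -> X).
Hypotheses (hf : dga_hom f) (fK : cancel f g).
Hypothesis fs : forall v, f (delta v) = delta (s v).

Lemma dga_hom_delta_inj : injective s.
Proof.
move=> v w vw; apply: (@delta_inj X x0); apply: (can_inj fK).
by rewrite !fs vw.
Qed.

Lemma dga_hom_arc v w :
  f (delta v * coboundary (delta w)) = delta (s v) * coboundary (delta (s w)).
Proof.
rewrite -!fs [LHS](dga_hom_mul hf); congr (_ * _).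
exact: (dga_hom_diff hf).
Qed.

Lemma dga_hom_edge : graph_hom s.
Proof.
move=> v w /(edge_delta x0)[vw dvw]; apply/(edge_delta x0); split.
  by move/dga_hom_delta_inj.
by rewrite -dga_hom_arc -(dga_hom0 hf) => /(can_inj fK).
Qed.

(** The value at v is the factor in delta v * a * delta v = a(v) delta v, and
    f maps this identity to the same one at s v. *)
Lemma dga_hom_vertex (a : A) v :
  (f a : cochain x0) (inl (s v)) = (a : cochain x0) (inl v).
Proof.
have : f (delta v * a * delta v) = delta (s v) * f a * delta (s v).
  by rewrite !(dga_hom_mul hf) !fs.
rewrite [X in f X]delta_sandwich [RHS]delta_sandwich (dga_homZ hf) fs.
move/(congr1 (fun b : cochain x0 => b (inl (s v)))).
by rewrite !cochainZ delta_refl !mulr1.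
Qed.

(** Here the factor is the one in [delta_arc]; f fixes it because f commutes
    with the differential. *)
Lemma dga_hom_edge_value (hs : graph_hom s) (a : A) e :
  (f a : cochain x0) (inr (arc_map hs e)) = (a : cochain x0) (inr e).
Proof.
have : f (delta (src e) * a * delta (tgt e)) =
    delta (s (src e)) * f a * delta (s (tgt e)).
  by rewrite !(dga_hom_mul hf) !fs.
rewrite [X in f X]delta_arc (dga_homZ hf) dga_hom_arc.
rewrite [RHS](delta_arc _ (arc_map hs e)).
move/(congr1 (fun b : cochain x0 => b (inr (arc_map hs e)))).
by rewrite !cochainZ (delta_arc_refl x0 (arc_map hs e)) !mulr1.
Qed.

Lemma dga_hom_pullback (hs : graph_hom s) (a : A) : pullback x0 x0 hs (f a) = a.
Proof.
apply/funext => -[v|e]; [exact: dga_hom_vertex | exact: dga_hom_edge_value].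
Qed.
End DeltaMap.

Lemma Aut_graph_hom (s : Aut_graph X) :
  graph_hom (fwd (val s)) /\ graph_hom (bwd (val s)).
Proof. exact/asboolP/(valP s). Qed.

(** Cochains are contravariant in the graph, hence the pullback along the
    inverse of s. *)
Definition relabel_selfbij (s : Aut_graph X) : selfbij A :=
  let sf := proj1 (Aut_graph_hom s) in
  let sb := proj2 (Aut_graph_hom s) in
  @SelfBij A (pullback x0 x0 sb) (pullback x0 x0 sf)
    (pullback_cancel x0 x0 sf sb (fwdK (val s)))
    (pullback_cancel x0 x0 sb sf (bwdK (val s))).

Fact relabel_dga_aut s : relabel_selfbij s \in @dga_aut A.
Proof. by apply/asboolP; split; exact: pullback_dga_hom. Qed.

Definition relabel (s : Aut_graph X) : Aut_dga A :=
  exist _ (relabel_selfbij s) (relabel_dga_aut s).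

Fact relabelM : {morph relabel : s t / (s * t)%g}.
Proof.
move=> s t; apply/val_inj/selfbij_ext => a; apply/funext => -[v|e] //.
by congr (a (inr _)); apply: arc_ext.
Qed.
HB.instance Definition _ :=
  isMultiplicative.Build (Aut_graph X) (Aut_dga A) relabel relabelM.

Lemma relabel_delta s v :
  fwd (val (relabel s)) (delta v) = delta (fwd (val s) v).
Proof. exact: pullback_delta (bwdK _) (fwdK _). Qed.

Lemma relabel_inj : injective relabel.
Proof.
move=> s t st; apply/val_inj/selfbij_ext => v; apply: (@delta_inj X x0).
by rewrite -!relabel_delta st.
Qed.

Lemma relabel_surj h : exists s, relabel s = h.
Proof.
have [hf hg] : dga_hom (fwd (val h)) /\ dga_hom (bwd (val h)).
  exact/asboolP/(valP h).
have fK := fwdK (val h); have gK := bwdK (val h).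
have [s fs] := dga_hom_delta hf hg fK gK.
have [t gt] := dga_hom_delta hg hf gK fK.
have hs := dga_hom_edge hf fK fs; have ht := dga_hom_edge hg gK gt.
have sK : cancel s t.
  by move=> v; apply: (@delta_inj X x0); rewrite -gt -fs fK.
have tK : cancel t s.
  by move=> v; apply: (@delta_inj X x0); rewrite -fs -gt gK.
have st_aut : SelfBij sK tK \in @graph_aut X by apply/asboolP.
exists (exist _ (SelfBij sK tK) st_aut); apply/val_inj/selfbij_ext => a /=.
rewrite -[RHS](pullback_cancel x0 x0 ht hs tK) (dga_hom_pullback hf fs).
apply/funext => -[v|e] //; rewrite /pullback /=.
by congr (a (inr _)); apply: arc_ext.
Qed.

Theorem Aut_cochain_dga : isomorphic (Aut_graph X) (Aut_dga A).
Proof. exact: inj_surj_isomorphic relabel_inj relabel_surj. Qed.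
End CochainAut.

(** * Groups in the class are detected by DGAs *)

Definition point_graph : graph :=
  @Graph unit (fun _ _ => False) (fun _ _ => id) (fun _ => id).

(** The cochain algebra needs a vertex, so the empty graph is replaced by a
    point, which has the same trivial automorphism group. *)
Lemma embeds_dga_of_graph (G : groupType) (X : graph) :
  isomorphic G (Aut_graph X) ->
  exists A : dga, embeds G (Aut_dga A) /\ embeds (Aut_dga A) G.
Proof.
move=> GX.
suff [Y [y0 XY]] :
    exists (Y : graph) (_ : Y), isomorphic (Aut_graph X) (Aut_graph Y).
  have YA := Aut_cochain_dga y0.
  exists (cochain_dga y0); split.
    apply: embeds_trans (isomorphic_embeds YA).
    exact: embeds_trans (isomorphic_embeds GX) (isomorphic_embeds XY).
  apply: embeds_trans (isomorphic_embeds (isomorphic_sym YA)) _.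
  exact: embeds_trans (isomorphic_embeds (isomorphic_sym XY))
    (isomorphic_embeds (isomorphic_sym GX)).
have [[x0 _]|noX] := pselect (exists x0 : X, True).
  by exists X, x0; exists idfun; exists idfun.
exists point_graph, tt; apply: subsingleton_isomorphic.
  by apply: subsingleton_Aut_graph => v; case: noX; exists v.
by apply: subsingleton_Aut_graph => -[] [].
Qed.

Lemma embeds_of_embeds_Aut_dga (G H : groupType) : in_class G ->
  (forall A : dga, embeds G (Aut_dga A) -> embeds H (Aut_dga A)) -> embeds H G.
Proof.
case=> -[X [_ _ /embeds_dga_of_graph[A [GA AG]]]] _ _ /(_ A GA).
by move/embeds_trans; apply.
Qed.

Theorem theorem1p2 (G H : groupType) (hG : in_class G) (hH : in_class H) :
  isomorphic G H <->
  (forall A : dga, embeds G (Aut_dga A) <-> embeds H (Aut_dga A)).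
Proof.
split=> [GH A|GH].
  split; apply: embeds_trans; last exact: isomorphic_embeds.
  exact/isomorphic_embeds/isomorphic_sym.
apply: co_hopfian_isomorphic (class_co_hopfian hG) _ _.
  by apply: embeds_of_embeds_Aut_dga hH _ => A /GH.
by apply: embeds_of_embeds_Aut_dga hG _ => A /GH.
Qed.
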